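(* If $G$ and $H$ are arbitrary graphs, then $$\alpha(G)\,\mathrm{DOM}(H)\ \le\ \mathrm{DOM}(G\circ H)\ \le\ \min\{\mathrm{DOM}(G)\,n(H),\ \mathrm{DOM}(H)\,n(G)\}.$$
   Context: Graphs are finite, simple and undirected (with at least one vertex); $n(G)$ denotes the order of $G$ and $\alpha(G)$ its independence number. An orientation of $G$ is a digraph obtained by directing every edge of $G$ in exactly one of its two possible directions. In a digraph $D$ with vertex set $V(D)$ and arc set $A(D)$, a vertex $u$ dominates $v$ if $(u,v)\in A(D)$; a set $S\subseteq V(D)$ is a dominating set if every vertex of $V(D)\setminus S$ is dominated by some vertex of $S$; $\gamma(D)$ is the smallest cardinality of a dominating set of $D$. The orientable domination number of a graph $G$ is $\mathrm{DOM}(G)=\max\{\gamma(D): D \text{ is an orientation of } G\}$. The lexicographic product $G\circ H$ has vertex set $V(G)\times V(H)$, and $(x,y)$, $(u,v)$ are adjacent if either $xu\in E(G)$, or $x=u$ and $yv\in E(H)$. *)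

(* Defs.v *)
From mathcomp Require Import all_boot.

Set Implicit Arguments.
Unset Strict Implicit.
Unset Printing Implicit Defensive.

Record sgraph := SGraph {
  vertex :> finType;
  adj : rel vertex;
  adj_sym : symmetric adj;
  adj_irrefl : irreflexive adj;
  vertex_gt0 : 0 < #|vertex|
}.

Definition independent (G : sgraph) (S : {set G}) : bool :=
  [forall u in S, forall v in S, ~~ adj u v].

Definition alpha (G : sgraph) : nat :=
  \max_(S : {set G} | independent S) #|S|.

(* A digraph on the vertex type T is given by its set A of arcs;
   (u, v) \in A means that u dominates v. *)

Definition dominating (T : finType) (A : {set T * T}) (S : {set T}) : bool :=
  [forall v in ~: S, exists u in S, (u, v) \in A].

(* [set: T] dominates every digraph on T, so the arg min ranges over a
   nonempty family. *)
Definition gamma (T : finType) (A : {set T * T}) : nat :=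
  #|[arg min_(S < [set: T] | dominating A S) #|S|]|.

Definition orientation (G : sgraph) (A : {set G * G}) : bool :=
  [forall u : G, forall v : G,
     if adj u v then ((u, v) \in A) (+) ((v, u) \in A)
     else (u, v) \notin A].

(* Every graph has an orientation (order the vertices), so the default value 0
   of an empty \max plays no role. *)
Definition DOM (G : sgraph) : nat :=
  \max_(A : {set G * G} | orientation A) gamma A.

Section Lexicographic.
Variables G H : sgraph.

Definition lex_adj : rel (G * H) := fun p q =>
  adj p.1 q.1 || (p.1 == q.1) && adj p.2 q.2.

Fact lex_adj_sym : symmetric lex_adj.
Proof.
by move=> p q; rewrite /lex_adj adj_sym (eq_sym p.1) (adj_sym p.2).
Qed.

Fact lex_adj_irrefl : irreflexive lex_adj.
Proof. by move=> p; rewrite /lex_adj !adj_irrefl andbF. Qed.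

Fact lex_vertex_gt0 : 0 < #|{: G * H}|.
Proof. by rewrite card_prod muln_gt0 !vertex_gt0. Qed.

Definition lexprod : sgraph :=
  SGraph lex_adj_sym lex_adj_irrefl lex_vertex_gt0.

End Lexicographic.

(* Main.v *)
Require Import Defs.
From mathcomp Require Import all_boot.

(** Both bounds compare an orientation of the lexicographic product with the
    orientations that it induces on copies of the factors.

    Upper bounds: the product is partitioned into #|G| copies of H (fix the
    first coordinate) and also into #|H| copies of G (fix the second one).  An
    orientation of the product restricts to an orientation of each copy, which
    has a dominating set of size at most the orientable domination number of
    that factor; the union of these sets dominates the product.  Both bounds
    are thus instances of [DOM_le_cover].

    Lower bound: take a maximum independent set I of G.  Since no edge joins
    two vertices of I, G has an orientation in which no arc enters I
    ([orientation_avoiding]).  Orient the edges of the product between distinct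
    copies of H accordingly, and each copy of H by an orientation of H with
    largest domination number.  A copy of H over a vertex of I then receives no
    arc from outside, so a dominating set of the product contains a dominating
    set of each of these #|I| disjoint copies. *)

Set Implicit Arguments.
Unset Strict Implicit.
Unset Printing Implicit Defensive.

Lemma dominatingP (T : finType) (A : {set T * T}) (S : {set T}) :
  reflect (forall v, v \notin S -> exists2 u, u \in S & (u, v) \in A)
          (dominating A S).
Proof.
apply: (iffP forall_inP) => domS v.
  by move=> vS; apply/exists_inP/domS; rewrite inE.
by rewrite inE => vS; apply/exists_inP/domS.
Qed.

Lemma dominatingT (T : finType) (A : {set T * T}) : dominating A [set: T].
Proof. by apply/dominatingP => v; rewrite inE. Qed.

Lemma gamma_le (T : finType) (A : {set T * T}) (S : {set T}) :
  dominating A S -> gamma A <= #|S|.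
Proof.
rewrite /gamma; case: arg_minnP => [|S0 _ minS0]; last exact: minS0.
exact: dominatingT.
Qed.

Lemma gamma_attained (T : finType) (A : {set T * T}) :
  exists2 S : {set T}, dominating A S & #|S| = gamma A.
Proof.
rewrite /gamma; case: arg_minnP => [|S0 domS0 _]; first exact: dominatingT.
by exists S0.
Qed.

Lemma orientationP (G : sgraph) (A : {set G * G}) :
  reflect (forall u v, if adj u v then ((u, v) \in A) (+) ((v, u) \in A)
                       else (u, v) \notin A)
          (orientation A).
Proof.
apply: (iffP forallP) => oA u; first by move=> v; apply: (forallP (oA u)).
exact/forallP/oA.
Qed.

Lemma independentP (G : sgraph) (I : {set G}) :
  reflect {in I &, forall u v, ~~ adj u v} (independent I).
Proof.
apply: (iffP forall_inP) => indI u.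
  by move=> v uI; apply: (forall_inP (indI u uI)).
by move=> uI; apply/forall_inP => v; apply: indI.
Qed.

Lemma independent0 (G : sgraph) : independent (set0 : {set G}).
Proof. by apply/independentP => u v; rewrite inE. Qed.

(** Edges leaving I are directed outwards, which is unambiguous because I is
    independent; the edges off I follow an arbitrary linear order. *)
Lemma orientation_avoiding (G : sgraph) (I : {set G}) :
  independent I ->
  exists2 A : {set G * G}, orientation A &
    forall u v, v \in I -> (u, v) \notin A.
Proof.
move=> /independentP indI.
pose dir (u v : G) :=
  (v \notin I) && ((u \in I) || (enum_rank u < enum_rank v)).
exists [set p : G * G | adj p.1 p.2 && dir p.1 p.2]; last first.
  by move=> u v vI; rewrite inE /dir vI /= andbF.
apply/orientationP => u v; rewrite !inE /= /dir (adj_sym v u).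
case uv: (adj u v) => //=.
have [uI|uI] := boolP (u \in I); have [vI|vI] := boolP (v \in I) => //=.
  by have := indI u v uI vI; rewrite uv.
case: ltngtP => // /val_inj/enum_rank_inj eq_uv.
by rewrite eq_uv adj_irrefl in uv.
Qed.

Lemma DOM_ge (G : sgraph) (A : {set G * G}) : orientation A -> gamma A <= DOM G.
Proof. by move=> oA; apply: (leq_bigmax_cond (F := fun B => gamma B)). Qed.

Lemma DOM_attained (G : sgraph) :
  exists2 A : {set G * G}, orientation A & gamma A = DOM G.
Proof.
have [A oA _] := orientation_avoiding (independent0 G).
have nonempty : 0 < #|[pred B : {set G * G} | orientation B]|.
  by apply/card_gt0P; exists A.
have [B oB eqB] := eq_bigmax_cond (fun B => gamma B) nonempty.
by exists B.
Qed.

Lemma alpha_attained (G : sgraph) :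
  exists2 I : {set G}, independent I & #|I| = alpha G.
Proof.
have nonempty : 0 < #|[pred I : {set G} | independent I]|.
  by apply/card_gt0P; exists set0; apply: independent0.
have [I indI eqI] := eq_bigmax_cond (fun I : {set G} => #|I|) nonempty.
by exists I.
Qed.

Lemma orientation_preim (K L : sgraph) (f : L -> K) (A : {set K * K}) :
  (forall x y, adj (f x) (f y) = adj x y) -> orientation A ->
  orientation [set p : L * L | (f p.1, f p.2) \in A].
Proof.
move=> adjf /orientationP oA; apply/orientationP => x y.
by rewrite !inE /= -adjf; apply: oA.
Qed.

(** The union, over the copies of L, of minimum dominating sets for the induced
    orientations dominates K, since the copies cover K. *)
Lemma DOM_le_cover (K L : sgraph) (I : finType) (f : I -> L -> K) :
  (forall i x y, adj (f i x) (f i y) = adj x y) ->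
  (forall z, exists i x, z = f i x) ->
  DOM K <= DOM L * #|I|.
Proof.
move=> adjf coverf; apply/bigmax_leqP => A oA.
pose B i := [set p : L * L | (f i p.1, f i p.2) \in A].
have exS i : exists S : {set L}, dominating (B i) S && (#|S| == gamma (B i)).
  by have [S domS cardS] := gamma_attained (B i); exists S; rewrite domS cardS /=.
pose S i := xchoose (exS i).
have domS i : dominating (B i) (S i) by case/andP: (xchooseP (exS i)).
have cardS i : #|S i| <= DOM L.
  case/andP: (xchooseP (exS i)) => _ /eqP ->.
  exact/DOM_ge/orientation_preim.
have domU : dominating A (\bigcup_i f i @: S i).
  apply/dominatingP => z; have [i [x ->]] := coverf z => xU.
  have xS : x \notin S i.
    by apply: contra xU => xS; apply/bigcupP; exists i => //; apply: imset_f.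
  have /dominatingP/(_ x xS)[u uS] := domS i; rewrite inE /= => ux.
  by exists (f i u) => //; apply/bigcupP; exists i => //; apply: imset_f.
apply: leq_trans (gamma_le domU) _.
apply: (@leq_trans (\sum_i #|S i|)); last first.
  by rewrite mulnC -sum_nat_const; apply: leq_sum.
apply: (big_ind2 (fun (X : {set K}) n => #|X| <= n)) => [|X m Y n|i _].
- by rewrite cards0.
- by move=> leX leY; apply: leq_trans (leq_card_setU X Y) (leq_add leX leY).
- exact: leq_imset_card.
Qed.

Definition lex_arcs (G H : sgraph) (C : {set G * G}) (B : {set H * H}) :
  {set lexprod G H * lexprod G H} :=
  [set pq : lexprod G H * lexprod G H |
    ((pq.1.1, pq.2.1) \in C) ||
    (pq.1.1 == pq.2.1) && ((pq.1.2, pq.2.2) \in B)].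

Lemma orientation_lex (G H : sgraph) (C : {set G * G}) (B : {set H * H}) :
  orientation C -> orientation B -> orientation (lex_arcs C B).
Proof.
move=> /orientationP oC /orientationP oB.
apply/orientationP => -[x y] [u v]; rewrite !inE /= /lex_adj /=.
have [<-|_] := eqVneq x u.
  by have := oC x x; rewrite adj_irrefl => /negPf ->; apply: oB.
by rewrite /= !orbF; apply: oC.
Qed.

(** The copies of H over I receive no arc from outside, so a dominating set of
    the product meets each of them in a dominating set of that copy. *)
Lemma gamma_lex_ge (G H : sgraph) (I : {set G})
    (C : {set G * G}) (B : {set H * H}) :
  (forall u v, v \in I -> (u, v) \notin C) ->
  #|I| * gamma B <= gamma (lex_arcs C B).
Proof.
move=> avoidI; have [S /dominatingP domS <-] := gamma_attained (lex_arcs C B).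
pose fiber x := [set y : H | ((x, y) : lexprod G H) \in S].
have domF x : x \in I -> dominating B (fiber x).
  move=> xI; apply/dominatingP => y; rewrite inE => /domS[[u v] uvS].
  rewrite inE /= (negPf (avoidI u x xI)) /= => /andP[/eqP eq_ux vy].
  by exists v; rewrite // inE -eq_ux.
apply: (@leq_trans (\sum_(x in I) #|fiber x|)).
  by rewrite -sum_nat_const; apply: leq_sum => x xI; apply/gamma_le/domF.
apply: (@leq_trans (\sum_x #|fiber x|)).
  by rewrite [leqRHS](bigID (mem I)) leq_addr.
under eq_bigr do rewrite -sum1_card.
rewrite pair_big_dep /= -sum1_card.
by rewrite (eq_bigl (mem S)) // => -[x y]; rewrite inE.
Qed.

Theorem proposition5p1 (G H : sgraph) :
  alpha G * DOM H <= DOM (lexprod G H) <= minn (DOM G * #|H|) (DOM H * #|G|).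
Proof.
apply/andP; split.
  have [I indI <-] := alpha_attained G.
  have [B oB <-] := DOM_attained H.
  have [C oC avoidI] := orientation_avoiding indI.
  exact: leq_trans (gamma_lex_ge B avoidI) (DOM_ge (orientation_lex oC oB)).
rewrite leq_min; apply/andP; split.
  apply: (@DOM_le_cover (lexprod G H) G H (fun y x => (x, y))) => [y x u|[x y]].
    by rewrite /= /lex_adj /= adj_irrefl andbF orbF.
  by exists y, x.
apply: (@DOM_le_cover (lexprod G H) H G (fun x y => (x, y))) => [x y v|[x y]].
  by rewrite /= /lex_adj /= adj_irrefl eqxx.
by exists x, y.
Qed.
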